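(* Let $q=2^n>2$. Let $\{\theta_i\}_{i=0}^{q}$ be an ovoidal fibration of $PG(3,q)$, let $\mathcal{L}(\theta_0)$ be the set of all tangent lines to $\theta_0$, and let $W(q)$ be the symplectic generalized quadrangle whose points are all the points of $PG(3,q)$ and whose line set is $\mathcal{L}(\theta_0)$. Let $m$ be a line of $PG(3,q)$ not in $\mathcal{L}(\theta_0)$ and let $m^{\perp}$ be its perp in $W(q)$. Then $m$ and $m^{\perp}$ are tangent to distinct ovoids of the fibration, each distinct from $\theta_0$; that is, there are $i\neq j$ in $\{1,\dots,q\}$ such that $m$ is tangent to $\theta_i$ and $m^{\perp}$ is tangent to $\theta_j$.
   Context: $PG(3,q)$ is the 3-dimensional projective space over $\mathbb{F}_q$. An ovoid of $PG(3,q)$ is a set of $q^2+1$ points, no three collinear. A line is tangent to an ovoid if it meets it in exactly one point. An ovoidal fibration of $PG(3,q)$ is a set $\{\theta_i\}_{i=0}^{q}$ of $q+1$ ovoids of $PG(3,q)$ partitioning the point set of $PG(3,q)$. For $q$ even (Segre), given an ovoid $\theta_0$ there is a nondegenerate symplectic (alternating) form on $\mathbb{F}_q^4$, unique up to scalar, whose totally isotropic lines are precisely the tangent lines to $\theta_0$; for a line $m$ of $PG(3,q)$, $m^{\perp}$ denotes the line consisting of the points orthogonal, with respect to this form, to all points of $m$. *)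

(* Defs.v *)
From HB Require Import structures.
From mathcomp Require Import all_boot all_order all_algebra.

Set Implicit Arguments.
Unset Strict Implicit.
Unset Printing Implicit Defensive.

Import GRing.Theory.
Local Open Scope ring_scope.

Record point (F : finFieldType) : predArgType := Point {
  point_space :> {vspace 'rV[F]_4};
  _ : \dim point_space == 1%N
}.

Section PointFinite.
Variable F : finFieldType.

HB.instance Definition _ := [isSub of point F for @point_space F].
HB.instance Definition _ := [Choice of point F by <:].

(* The library has no finType instance on {vspace _}; a point is encoded by the
   finite set of the vectors it contains. *)
Definition point_vectors (p : point F) : {set 'rV[F]_4} :=
  [set v | v \in point_space p].

Definition point_of_vectors (A : {set 'rV[F]_4}) : option (point F) :=
  insub <<enum A>>%VS.

Lemma point_vectorsK : pcancel point_vectors point_of_vectors.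
Proof.
move=> p; rewrite /point_of_vectors.
suff -> : <<enum (point_vectors p)>>%VS = val p by rewrite valK.
apply/eqP; rewrite eqEsubv; apply/andP; split.
  by apply/span_subvP => v; rewrite mem_enum inE.
by apply/subvP => v pv; apply: memv_span; rewrite mem_enum inE.
Qed.

HB.instance Definition _ : isCountable (point F) :=
  PCanIsCountable point_vectorsK.
HB.instance Definition _ : isFinite (point F) := PCanIsFinite point_vectorsK.

End PointFinite.

Section Ovoids.
Variable F : finFieldType.
Local Notation V := 'rV[F]_4.
Implicit Types (O : {set point F}) (l : {vspace V}) (p : point F).

Definition is_line l : bool := \dim l == 2%N.

Definition points_on l : {set point F} := [set p : point F | (p <= l)%VS].

Definition collinear p1 p2 p3 : Prop :=
  exists2 l, is_line l
    & [/\ p1 \in points_on l, p2 \in points_on l & p3 \in points_on l].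

Definition ovoid O : Prop :=
  #|O| = (#|F| ^ 2 + 1)%N /\
  (forall p1 p2 p3, p1 \in O -> p2 \in O -> p3 \in O ->
     uniq [:: p1; p2; p3] -> ~ collinear p1 p2 p3).

Definition tangent O l : bool := is_line l && (#|O :&: points_on l| == 1%N).

(* The classes of an ovoidal fibration are indexed by 0, ..., q with q = #|F|. *)
Definition ovoidal_fibration (theta : 'I_#|F|.+1 -> {set point F}) : Prop :=
  [/\ forall i, ovoid (theta i),
      forall i j, i != j -> [disjoint theta i & theta j]
    & forall p, exists i, p \in theta i].

(* [is_psymplectic] contains nondegeneracy, skew-symmetry and, in characteristic
   2, the alternating condition B u u = 0; [orthov B l] is the orthogonal of l,
   so [l <= orthov B l] says that l is totally isotropic. *)
Definition tangent_symplectic_form (B : {skew_symmetric V}) O : Prop :=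
  is_psymplectic B /\
  (forall l, is_line l -> (l <= orthov B l)%VS <-> tangent O l).

End Ovoids.

(* Main.v *)
Require Import Defs.
From HB Require Import structures.
From mathcomp Require Import all_boot all_order all_algebra all_field.
From mathcomp Require Import zify ring.

Set Implicit Arguments.
Unset Strict Implicit.
Unset Printing Implicit Defensive.

Import GRing.Theory.

(** Write [q] for the order of the field, a power of two greater than [2].

    Stars. By Segre, the tangents to an ovoid through a point [z] are the lines
    through [z] of a plane, here called the star of [z] ([star_exists]); it is
    the polar plane of [z] in the symplectic polarity of the ovoid.  The proof
    rests on the nucleus property of planar sections with [q + 1] points
    ([two_tangents_nucleus]) and on the bound [q^2 + 1] for caps ([cap_bound]),
    which puts a secant through every point off the ovoid.

    Covering. An ovoid meets a line in at most two points, and the [q + 1]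
    points of a line are partitioned by the fibration; as [q + 1] is odd, every
    line is tangent to some ovoid of the fibration ([tangent_some]).  Hence the
    [q + 1] stars of a point [z] cover the space.  Fewer than [q + 1] planes
    through [z] have too few points for that, so the stars of [z] with respect
    to distinct ovoids are distinct ([stars_distinct]).

    Polarities. Every non-tangent line [m] of the first ovoid is tangent to some
    other ovoid, and so is its perp, which is not tangent to the first ovoid
    either.  Suppose that both are tangent to the same ovoid, and let [B'] be the
    form of the polarity of this ovoid.  The operator [g] such that
    [B' x y = B (g x) y] exchanges [m] and its perp, and its square is a scalar
    on [m]: for [u] in [m], [g (g u)] is in [m] and orthogonal to [u].  Scalars
    are squares in characteristic two, so [g (g u) = t^2 u] for some [t], and
    [z = g u + t u] is an eigenvector of [g]: the star of [z] is the same for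
    both ovoids, a contradiction.  [star_meets_orthov] runs this argument on the
    stars themselves, without the form [B'].  *)

(* Atoms are compared syntactically: simplification first makes the cardinals of
   the same set equal as terms. *)
Ltac arith := clear; simpl; lia.
Ltac narith := clear; simpl; nia.

(** * Points, lines and planes *)

Section Counting.
Variable F : finFieldType.
Local Notation V := 'rV[F]_4.
Local Notation q := #|F|.
Implicit Types (K : {set point F}) (S T : {vspace V}) (p x z : point F).

Lemma q_gt1 : 1 < q.
Proof. exact: finNzRing_gt1. Qed.

Lemma dim_point p : \dim p = 1.
Proof. by case: p => U /= /eqP. Qed.

Lemma vec_point_subproof (v : V) : v != 0%R -> \dim <[v]> == 1.
Proof. by rewrite dim_vline => ->. Qed.

Definition vec_point (v : V) (v0 : v != 0%R) : point F :=
  Point (vec_point_subproof v0).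

Lemma point_eqE p x : (p <= x)%VS = (p == x).
Proof.
apply/idP/eqP => [px | ->]; last exact: subvv.
by apply/val_inj/eqP; rewrite eqEdim px !dim_point.
Qed.

Lemma point_sub_memE (v : V) (v0 : v != 0%R) p :
  (v \in (p : {vspace V})) = (p == vec_point v0).
Proof. by rewrite eq_sym -point_eqE memvE. Qed.

Lemma in_points S p : (p \in points_on S) = (p <= S)%VS.
Proof. by rewrite inE. Qed.

Lemma card_points S : #|points_on S| * q.-1 = (q ^ \dim S).-1.
Proof.
have card0 (U : {vspace V}) : #|[set v : V | (v \in U) && (v != 0%R)]| = (q ^ \dim U).-1.
  rewrite -card_vspace [in RHS](cardD1 (0%R : V)) mem0v /=.
  by apply: eq_card => v; rewrite !inE andbC.
rewrite -card0 -[RHS]sum1dep_card -sum_nat_const.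
transitivity (\sum_(v : V | (v \in S) && (v != 0%R))
                 \sum_(p in points_on S | v \in (p : {vspace V})) 1); last first.
  apply: eq_bigr => v /andP[vS v0].
  rewrite (big_pred1 (vec_point v0)) // => p.
  rewrite point_sub_memE !inE andb_idl // => /eqP->.
  by rewrite /= -memvE.
rewrite (exchange_big_dep (fun p => p \in points_on S)) /=; last first.
  by move=> v p _ /andP[].
apply: eq_bigr => p pS; rewrite sum1dep_card; have := card0 p; rewrite dim_point expn1 => <-.
rewrite inE in pS; apply: eq_card => v; rewrite !inE pS /=.
case vp: (v \in (p : {vspace V})); rewrite ?andbF ?andbT //=.
by rewrite (subvP pS _ vp).
Qed.

Lemma card_points_line S : \dim S = 2 -> #|points_on S| = q.+1.
Proof. move=> d; have := card_points S; rewrite d; have := q_gt1; nia. Qed.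

Lemma card_points_plane S : \dim S = 3 -> #|points_on S| = q ^ 2 + q + 1.
Proof. move=> d; have := card_points S; rewrite d; have := q_gt1; nia. Qed.

Lemma card_points_point S : \dim S = 1 -> #|points_on S| = 1.
Proof. move=> d; have := card_points S; rewrite d; have := q_gt1; nia. Qed.

Lemma dim_full : \dim {:V} = 4.
Proof. by rewrite dimvf /dim /= mul1n. Qed.

Lemma card_point : #|{: point F}| = q ^ 3 + q ^ 2 + q + 1.
Proof.
have -> : #|{: point F}| = #|points_on (fullv : {vspace V})|.
  by apply: eq_card => p; rewrite !inE subvf.
by have := card_points (fullv : {vspace V}); rewrite dim_full; have := q_gt1; nia.
Qed.

Lemma dim_join S p : ~~ (p <= S)%VS -> \dim (S + p) = (\dim S).+1.
Proof.
move=> pS; have := dimv_sum_cap S p; rewrite dim_point addn1.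
suff -> : \dim (S :&: p) = 0 by rewrite addn0.
apply/eqP; rewrite -leqn0 -ltnS.
have := dimv_leqif_eq (capvSr S p); rewrite dim_point => -[le1 e].
rewrite ltn_neqAle e le1 andbT.
by apply: contra pS => /eqP <-; exact: capvSl.
Qed.

Lemma join_line p x : p != x -> \dim (p + x) = 2.
Proof. by move=> px; rewrite dim_join ?dim_point // point_eqE eq_sym. Qed.

Lemma join_exchange S x p :
  (p <= S + x)%VS -> ~~ (p <= S)%VS -> (S + p = S + x)%VS.
Proof.
move=> px pS; apply/eqP; rewrite eqEdim subv_add addvSl px (dim_join pS) /=.
case xS: (x <= S)%VS; last by rewrite dim_join ?xS.
by move: px; rewrite (addv_idPl xS) (negPf pS).
Qed.

Definition sect K S := #|K :&: points_on S|.

(** Points of a complement of [S] in [T]: each subspace of [T] containing [S] as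
    a hyperplane is [S + x] for exactly one such [x], which is how lines through a
    point and planes through a line are enumerated below. *)
Definition dirs T S := points_on (T :\: S).

Lemma dim_diff T S : (S <= T)%VS -> \dim (T :\: S) = \dim T - \dim S.
Proof. by move=> ST; rewrite -(dimv_cap_compl T S) (capv_idPr ST) addKn. Qed.

Lemma dirs_notin T S x : x \in dirs T S -> ~~ (x <= S)%VS.
Proof.
rewrite inE => xT; apply/negP => xS.
have : (x <= (T :\: S) :&: S)%VS by rewrite subv_cap xT.
by rewrite capv_diff subv0 -dimv_eq0 dim_point.
Qed.

Lemma dirs_sub T S x : (S <= T)%VS -> x \in dirs T S -> (S + x <= T)%VS.
Proof.
by move=> ST; rewrite inE subv_add ST => /subv_trans; apply; exact: diffvSl.
Qed.

Lemma dirs_unique T S p : (S <= T)%VS -> (p <= T)%VS -> ~~ (p <= S)%VS ->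
  #|[set x in dirs T S | (p <= S + x)%VS]| = 1.
Proof.
move=> ST pT pS.
have -> : [set x in dirs T S | (p <= S + x)%VS] = points_on ((T :\: S) :&: (S + p)).
  apply/setP => x; rewrite inE /dirs !in_points subv_cap.
  apply/andP/andP => -[xd px]; split=> //.
    by rewrite (join_exchange px pS) addvSr.
  have xS : ~~ (x <= S)%VS by apply: (@dirs_notin T); rewrite in_points.
  by rewrite (join_exchange px xS) addvSr.
apply: card_points_point.
have := dimv_sum_cap (T :\: S)%VS (S + p)%VS.
have -> : (T :\: S + (S + p) = T)%VS.
  by rewrite addvA addv_diff (addv_idPl ST) (addv_idPl pT).
rewrite dim_join // dim_diff //; have := dimvS ST; lia.
Qed.

(** The subspaces [S + x] partition the points of [T] outside [S]. *)
Lemma pencil_sum K T S : (S <= T)%VS ->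
  \sum_(x in dirs T S) sect K (S + x) + sect K S =
  sect K T + #|dirs T S| * sect K S.
Proof.
move=> ST.
have split U : (S <= U)%VS ->
    sect K U = sect K S + #|[set p in K | (p <= U)%VS && ~~ (p <= S)%VS]|.
  move=> SU; rewrite /sect -(cardsID (points_on S) (K :&: points_on U)).
  congr (_ + _); apply: eq_card => p; rewrite !inE.
    by case pS: (p <= S)%VS; rewrite ?andbF // (subv_trans pS SU) andbT.
  by rewrite andbC andbA.
rewrite (eq_bigr (fun x => sect K S +
           #|[set p in K | (p <= S + x)%VS && ~~ (p <= S)%VS]|)); last first.
  by move=> x _; apply: split; exact: addvSl.
rewrite big_split /= sum_nat_const (split T ST).
suff -> : \sum_(x in dirs T S) #|[set p in K | (p <= S + x)%VS && ~~ (p <= S)%VS]|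
   = #|[set p in K | (p <= T)%VS && ~~ (p <= S)%VS]|.
  by rewrite addnC [_ * _ + _]addnC addnA.
rewrite -[RHS]sum1_card.
under eq_bigr => x _ do rewrite -sum1_card.
rewrite (exchange_big_dep
  (fun p => p \in [set p in K | (p <= T)%VS && ~~ (p <= S)%VS])) /=; last first.
  move=> x p /(dirs_sub ST) xT; rewrite !inE => /and3P[-> pS ->].
  by rewrite (subv_trans pS xT).
apply: eq_bigr => p; rewrite inE => /and3P[pK pT pS].
rewrite sum1dep_card; apply: etrans (dirs_unique ST pT pS).
by apply: eq_card => x; rewrite !inE pK pS andbT.
Qed.

End Counting.

(** Double counting of the related pairs: there are at least [#|A|] and at most
    [#|B|] of them, so each [x] is in exactly one. *)
Lemma matching_unique (T1 T2 : finType) (A : {set T1}) (B : {set T2})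
    (r : T2 -> T1 -> bool) :
  (forall x, x \in A -> exists2 k, k \in B & r k x) ->
  (forall k x y, k \in B -> x \in A -> y \in A -> r k x -> r k y -> x = y) ->
  #|B| <= #|A| ->
  forall x k k', x \in A -> k \in B -> k' \in B -> r k x -> r k' x -> k = k'.
Proof.
move=> exB uniqA leBA x k k' xA kB k'B rk rk'; apply/eqP/negPn/negP => nkk'.
pose e x k : nat := (x \in A) && (k \in B) && r k x.
have elu : \sum_x \sum_k e x k = \sum_k \sum_x e x k by exact: exchange_big.
set l := \sum_x _ in elu; set u := \sum_k _ in elu.
have leu : u <= #|B|.
  rewrite -sum1_card [leqRHS]big_mkcond /=; apply: leq_sum => i _.
  rewrite /e.
  case iB: (i \in B); last by rewrite big1 // => j _; rewrite andbF.
  rewrite (eq_bigr (fun j => if (j \in A) && r i j then 1 else 0)); last first.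
    by move=> j _; rewrite andbT; case: (_ && _).
  rewrite -big_mkcond /= sum1_card; apply/card_le1P => a /andP[aA ra] b /=.
  rewrite inE; apply/idP/eqP => [/andP[bA rb]|->]; last by rewrite unfold_in aA.
  exact: uniqA rb ra.
suff : #|A| < l by lia.
rewrite /l (bigD1 x) //= (cardD1 x) xA add1n.
have two : 2 <= \sum_j e x j.
  rewrite /e (bigD1 k) //= (bigD1 k') 1?eq_sym //=.
  by rewrite xA kB k'B rk rk'.
apply: leq_trans (leq_add two (leqnn _)).
rewrite -addn2 addnC leq_add2l -sum1_card big_mkcond [leqRHS]big_mkcond /=.
apply: leq_sum => i _; rewrite !inE; case: (i =P x) => //= nix.
case iA: (i \in A) => //; have [j jB rj] := exB i iA.
by rewrite /e (bigD1 j) //= iA jB rj.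
Qed.

Lemma sum_le2 (I : finType) (A : {set I}) (f : I -> nat) c x y :
  x \in A -> y \in A -> y != x -> (forall i, i \in A -> f i <= c) ->
  \sum_(i in A) f i + 2 * c <= #|A| * c + f x + f y.
Proof.
move=> xA yA yx h; rewrite -sum_nat_const.
rewrite (bigD1 x) // (bigD1 y) /= ?yA //.
rewrite [in leqRHS](bigD1 x) // [in leqRHS](bigD1 y) /= ?yA //.
set r := bigop _ _ _; set r' := bigop _ _ _.
suff : r <= r' by lia.
by apply: leq_sum => i /andP[/andP[id _] _]; apply/h.
Qed.

Lemma sum_le1 (I : finType) (A : {set I}) (f : I -> nat) c x :
  x \in A -> (forall i, i \in A -> f i <= c) ->
  \sum_(i in A) f i + c <= #|A| * c + f x.
Proof.
move=> xA h; rewrite -sum_nat_const (bigD1 x) // [in leqRHS](bigD1 x) //=.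
set r := bigop _ _ _; set r' := bigop _ _ _.
suff : r <= r' by lia.
by apply: leq_sum => i /andP[id _]; apply/h.
Qed.

Section Pencils.
Variable F : finFieldType.
Local Notation V := 'rV[F]_4.
Local Notation q := #|F|.
Implicit Types (K : {set point F}) (S T U P Q l L : {vspace V}).
Implicit Types (p x y z k N : point F).

Lemma sectS K S T : (S <= T)%VS -> sect K S <= sect K T.
Proof.
move=> ST; apply/subset_leq_card/setIS/subsetP => p; rewrite !in_points => pS.
exact: subv_trans ST.
Qed.

Lemma sect_gt0 K S p : p \in K -> (p <= S)%VS -> 0 < sect K S.
Proof. by move=> pK pS; apply/card_gt0P; exists p; rewrite !inE pK. Qed.

Lemma sect_gt1 K S p x : p \in K -> (p <= S)%VS -> x \in K -> (x <= S)%VS ->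
  p != x -> 1 < sect K S.
Proof.
by move=> pK pS xK xS px; apply/card_gt1P; exists p, x; rewrite // !inE ?pK ?xK.
Qed.

Lemma sect_gt0P K S : reflect (exists2 p, p \in K & (p <= S)%VS) (0 < sect K S).
Proof.
rewrite /sect; apply: (iffP card_gt0P) => [[p]|[p pK pS]].
  by rewrite !inE => /andP[]; exists p.
by exists p; rewrite !inE pK.
Qed.

Lemma sect_gt1P K S p : 1 < sect K S ->
  exists k, [/\ k \in K, (k <= S)%VS & k != p].
Proof.
move=> /card_gt1P[x [y []]]; rewrite !inE => /andP[xK xS] /andP[yK yS] xy.
case: (x =P p) => [xp|/eqP]; last by exists x.
by exists y; rewrite -xp eq_sym.
Qed.

Lemma sect_point K p : sect K p = (p \in K).
Proof.
case pK: (p \in K).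
  apply: etrans (cards1 p); apply: eq_card => x; rewrite !inE point_eqE.
  by case: (x =P p) => [->|]; rewrite ?pK ?andbF.
apply: eq_card0 => x; rewrite !inE point_eqE.
by case: (x =P p) => [->|]; rewrite ?pK ?andbF.
Qed.

Lemma sect_full K : sect K fullv = #|K|.
Proof. by apply: eq_card => p; rewrite !inE subvf andbT. Qed.

Lemma line_join l p x : is_line l -> (p <= l)%VS -> (x <= l)%VS -> p != x ->
  (p + x = l)%VS.
Proof.
move=> /eqP dl pl xl px; apply/eqP.
by rewrite eqEdim subv_add pl xl dl join_line.
Qed.

Lemma is_line_join p x : p != x -> is_line (p + x).
Proof. by move=> px; rewrite /is_line join_line. Qed.

Lemma point_notin U S : ~~ (U <= S)%VS ->
  exists2 p : point F, (p <= U)%VS & ~~ (p <= S)%VS.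
Proof.
move=> /subvPn[v vU vS]; have v0 : v != 0%R by apply: contraNneq vS => ->; rewrite mem0v.
by exists (vec_point v0); rewrite -memvE.
Qed.

Lemma point_in_ge U n : n < \dim U -> forall S, \dim S <= n ->
  exists2 p : point F, (p <= U)%VS & ~~ (p <= S)%VS.
Proof.
move=> nU S Sn; apply: point_notin; apply/negP => /dimvS US.
by have := leq_trans nU (leq_trans US Sn); rewrite ltnn.
Qed.

Lemma meet_line_in_plane P Q : \dim P = 3 -> \dim Q = 3 ->
  forall z, (z <= P)%VS -> (z <= Q)%VS ->
  exists l, [/\ is_line l, (z <= l)%VS, (l <= P)%VS & (l <= Q)%VS].
Proof.
move=> dP dQ z zP zQ.
have dPQ : 1 < \dim (P :&: Q).
  have := dimv_sum_cap P Q; have := dimvS (subvf (P + Q)%VS); rewrite dim_full dP dQ; lia.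
have [y yPQ yz] := point_in_ge dPQ (eq_leq (dim_point z)).
exists (z + y)%VS; rewrite addvSl !subv_add zP zQ /=.
by move: yPQ yz; rewrite subv_cap point_eqE eq_sym => /andP[-> ->] /is_line_join.
Qed.

Lemma dirs_cover T S U : (S <= U)%VS -> (U <= T)%VS -> \dim U = (\dim S).+1 ->
  exists2 x, x \in dirs T S & (S + x)%VS = U.
Proof.
move=> SU UT dU.
have [p pU pS] : exists2 p : point F, (p <= U)%VS & ~~ (p <= S)%VS.
  by apply: point_notin; apply/negP => /dimvS; rewrite dU ltnn.
have := dirs_unique (subv_trans SU UT) (subv_trans pU UT) pS.
move=> /eqP/cards1P[x /setP/(_ x)]; rewrite !inE eqxx => /andP[xT px].
exists x; first by rewrite in_points.
rewrite -(join_exchange px pS); apply/eqP.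
by rewrite eqEdim subv_add SU pU (dim_join pS) dU leqnn.
Qed.

Lemma card_dirs_line T S : \dim T = (\dim S).+2 -> (S <= T)%VS -> #|dirs T S| = q.+1.
Proof. by move=> dT ST; apply: card_points_line; rewrite dim_diff // dT; lia. Qed.

Lemma card_dirs_plane T S : \dim T = (\dim S).+3 -> (S <= T)%VS ->
  #|dirs T S| = q ^ 2 + q + 1.
Proof. by move=> dT ST; apply: card_points_plane; rewrite dim_diff // dT; lia. Qed.

Definition between S T U := [&& (S <= U)%VS, (U <= T)%VS & \dim U == (\dim S).+1].

Lemma between_dir S T x : (S <= T)%VS -> x \in dirs T S -> between S T (S + x).
Proof.
by move=> ST xd; rewrite /between addvSl dirs_sub //= (dim_join (dirs_notin xd)).
Qed.

Lemma dir_between S T U : between S T U -> exists2 x, x \in dirs T S & (S + x)%VS = U.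
Proof. by case/and3P => SU UT /eqP dU; apply: dirs_cover. Qed.

Lemma pencil_lt K S T c : (S <= T)%VS ->
  sect K T + #|dirs T S| * sect K S < #|dirs T S| * c + sect K S ->
  exists2 U, between S T U & sect K U < c.
Proof.
move=> ST; rewrite -(pencil_sum K ST) ltn_add2r => lt.
case: (boolP [exists x in dirs T S, sect K (S + x) < c]) => [/exists_inP[x xd xc]|].
  by exists (S + x)%VS; rewrite // between_dir.
move=> /exists_inPn h; move: lt; rewrite ltnNge -sum_nat_const leq_sum // => x xd.
by rewrite leqNgt h.
Qed.

Lemma pencil_odd K S T : (S <= T)%VS ->
  odd (sect K T + #|dirs T S| * sect K S) != odd (sect K S) ->
  exists2 U, between S T U & odd (sect K U).
Proof.
move=> ST; rewrite -(pencil_sum K ST) oddD.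
case: (boolP [exists x in dirs T S, odd (sect K (S + x))]) => [/exists_inP[x xd xc]|].
  by exists (S + x)%VS; rewrite // between_dir.
move=> /exists_inPn h /negP[]; suff /negPf-> : ~~ odd (\sum_(x in dirs T S) sect K (S + x)) by [].
by elim/big_ind: _ => // a b; rewrite oddD => /negPf-> /negPf->.
Qed.

Lemma pencil_le K S T c : (S <= T)%VS -> (forall U, between S T U -> sect K U <= c) ->
  sect K T + #|dirs T S| * sect K S <= #|dirs T S| * c + sect K S.
Proof.
move=> ST h; rewrite leqNgt; apply/negP; rewrite -(pencil_sum K ST) ltn_add2r.
rewrite ltnNge -sum_nat_const leq_sum // => x xd; exact/h/between_dir.
Qed.

Lemma pencil_le2 K S T c U U' : (S <= T)%VS ->
  (forall U, between S T U -> sect K U <= c) -> between S T U -> between S T U' ->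
  U != U' -> sect K T + #|dirs T S| * sect K S + 2 * c <=
             #|dirs T S| * c + sect K S + sect K U + sect K U'.
Proof.
move=> ST h /dir_between[x xd <-] /dir_between[y yd <-] ne.
have yx : y != x by apply: contraNneq ne => ->.
rewrite -(pencil_sum K ST).
rewrite addnAC -[leqRHS]addnA [leqRHS]addnAC leq_add2r addnA.
exact: sum_le2 xd yd yx (fun i id => h _ (between_dir ST id)).
Qed.

Lemma pencil_le1 K S T c U : (S <= T)%VS ->
  (forall U, between S T U -> sect K U <= c) -> between S T U ->
  sect K T + #|dirs T S| * sect K S + c <= #|dirs T S| * c + sect K S + sect K U.
Proof.
move=> ST h /dir_between[x xd <-].
rewrite -(pencil_sum K ST) addnAC [leqRHS]addnAC leq_add2r.
exact: sum_le1 xd (fun i id => h _ (between_dir ST id)).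
Qed.

End Pencils.

(** * Planar sections of caps *)

Section Caps.
Variable F : finFieldType.
Local Notation V := 'rV[F]_4.
Local Notation q := #|F|.
Implicit Types (K : {set point F}) (S T U P Q l L : {vspace V}).
Implicit Types (p x y z k N : point F).

Definition cap K := forall l, is_line l -> sect K l <= 2.

Lemma tangent_line K l : tangent K l -> is_line l.
Proof. by case/andP. Qed.

Lemma tangent_sect K l : tangent K l -> sect K l = 1.
Proof. by case/andP => _ /eqP. Qed.

Lemma tangentI K l : is_line l -> sect K l = 1 -> tangent K l.
Proof. by move=> ll e; apply/andP; split; last apply/eqP. Qed.

Lemma tangent_contact K l : tangent K l -> exists2 k, k \in K & (k <= l)%VS.
Proof. by move=> /tangent_sect e; apply/sect_gt0P; rewrite e. Qed.

Lemma contact_uniq K S p k : sect K S = 1 -> p \in K -> (p <= S)%VS -> k \in K ->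
  (k <= S)%VS -> p = k.
Proof.
move=> e pK pl kK kl; apply/eqP/negPn/negP => pk.
by have := sect_gt1 pK pl kK kl pk; rewrite e.
Qed.

Lemma line_between z P l : is_line l -> (z <= l)%VS -> (l <= P)%VS -> between z P l.
Proof. by move=> /eqP dl zl lP; rewrite /between zl lP dl dim_point. Qed.

Lemma between_line z P l : between z P l -> [/\ is_line l, (z <= l)%VS & (l <= P)%VS].
Proof. by case/and3P => -> -> /eqP; rewrite /is_line dim_point => ->. Qed.

Lemma plane_between l Q : is_line l -> \dim Q = 3 -> (l <= Q)%VS -> between l fullv Q.
Proof. by move=> /eqP dl dQ lQ; rewrite /between lQ subvf dQ dl. Qed.

Lemma between_plane l Q : is_line l -> between l fullv Q -> \dim Q = 3 /\ (l <= Q)%VS.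
Proof. by move=> /eqP dl /and3P[-> _ /eqP->]; rewrite dl. Qed.

Lemma card_lines_in_plane P z : \dim P = 3 -> (z <= P)%VS -> #|dirs P z| = q + 1.
Proof. by move=> dP zP; rewrite card_dirs_line ?dP ?dim_point ?addn1. Qed.

Lemma card_planes_on_line l : is_line l -> #|dirs fullv l| = q + 1.
Proof. by move=> /eqP dl; rewrite card_dirs_line ?dim_full ?dl ?subvf ?addn1. Qed.

Lemma card_lines_on_point z : #|dirs fullv z| = q ^ 2 + q + 1.
Proof. by rewrite card_dirs_plane ?dim_full ?dim_point ?subvf. Qed.

Lemma dim_join_lines l l' z : is_line l -> is_line l' -> (z <= l)%VS -> (z <= l')%VS ->
  l != l' -> \dim (l + l') = 3.
Proof.
move=> ll ll' zl zl' ne; have dl' : 1 < \dim l' by rewrite (eqP ll').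
have [y yl' yz] := point_in_ge dl' (eq_leq (dim_point z)).
have zy : z != y by rewrite eq_sym -point_eqE.
have e' := line_join ll' zl' yl' zy.
have yl : ~~ (y <= l)%VS.
  by apply: contra ne => yl; rewrite -e' (line_join ll zl yl zy).
by rewrite -e' addvA (addv_idPl zl) (dim_join yl) (eqP ll).
Qed.

Lemma cap_between_le2 K P z : cap K -> forall l, between z P l -> sect K l <= 2.
Proof. by move=> cK l /between_line[ll _ _]; exact: cK. Qed.

Lemma arc_le K P : cap K -> \dim P = 3 -> sect K P <= q + 2.
Proof.
move=> cK dP; case: (posnP (sect K P)) => [->//|/sect_gt0P[p pK pP]].
have := pencil_le pP (@cap_between_le2 _ _ _ cK).
by rewrite card_lines_in_plane // sect_point pK; arith.
Qed.

Lemma arc_tangent_le K P l : cap K -> \dim P = 3 -> tangent K l -> (l <= P)%VS ->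
  sect K P <= q + 1.
Proof.
move=> cK dP tl lP; have [p pK pl] := tangent_contact tl.
have pP := subv_trans pl lP.
have := pencil_le1 pP (@cap_between_le2 _ _ _ cK)
  (line_between (tangent_line tl) pl lP).
by rewrite card_lines_in_plane // sect_point pK (tangent_sect tl); arith.
Qed.

(** The [q - 1] other lines of [P] through [p] carry at most one more point each. *)
Lemma arc_two_tangents_le K P l l' p : cap K -> \dim P = 3 ->
  tangent K l -> tangent K l' -> (l <= P)%VS -> (l' <= P)%VS ->
  p \in K -> (p <= l)%VS -> (p <= l')%VS -> l != l' -> sect K P <= q.
Proof.
move=> cK dP tl tl' lP l'P pK pl pl' ll'.
have pP := subv_trans pl lP.
have := pencil_le2 pP (@cap_between_le2 _ _ _ cK)
  (line_between (tangent_line tl) pl lP) (line_between (tangent_line tl') pl' l'P) ll'.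
rewrite card_lines_in_plane // sect_point pK.
by rewrite (tangent_sect tl) (tangent_sect tl'); arith.
Qed.

(** Parity: the lines of the plane through a point off an odd section partition
    it into blocks of at most two points. *)
Lemma odd_section_tangent K P z : cap K -> \dim P = 3 -> odd (sect K P) ->
  (z <= P)%VS -> z \notin K -> exists l, [/\ tangent K l, (z <= l)%VS & (l <= P)%VS].
Proof.
move=> cK dP oP zP zK.
have [|l /between_line[ll zl lP] ol] := @pencil_odd _ K z P zP.
  by rewrite sect_point (negPf zK) muln0 addn0 oP.
exists l; split=> //; apply: tangentI => //.
by have := cK _ ll; case: (sect _ _) ol => [|[|[|]]].
Qed.

Lemma tangent_at K P p : cap K -> \dim P = 3 -> sect K P <= q + 1 -> p \in K ->
  (p <= P)%VS -> exists l, [/\ tangent K l, (p <= l)%VS & (l <= P)%VS].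
Proof.
move=> cK dP leP pK pP.
have [|l /between_line[ll pl lP] ltl] := @pencil_lt _ K p P 2 pP.
  by rewrite sect_point pK card_lines_in_plane //; move: leP (q_gt1 F); arith.
exists l; split=> //; apply: tangentI => //.
by move: ltl (sect_gt0 pK pl); arith.
Qed.

Lemma not_secant_tangent K l : cap K -> is_line l -> 0 < sect K l -> sect K l != 2 ->
  tangent K l.
Proof. by move=> cK ll gt ne; apply: tangentI => //; move: (cK _ ll) gt ne; arith. Qed.

Lemma secant_not_tangent K l : sect K l = 2 -> tangent K l -> False.
Proof. by move=> e /tangent_sect; rewrite e. Qed.

(** On a secant [L] of an oval, each point off the oval lies on some tangent, and
    each point of the oval off [L] has a single tangent, which meets [L] once.  As
    both sets have [q - 1] points, no point of [L] is on two tangents. *)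
Lemma two_tangents_no_secant K P l1 l2 z L : cap K -> ~~ odd q -> \dim P = 3 ->
  sect K P = q + 1 -> tangent K l1 -> tangent K l2 -> (l1 <= P)%VS -> (l2 <= P)%VS ->
  (z <= l1)%VS -> (z <= l2)%VS -> l1 != l2 -> is_line L -> (z <= L)%VS ->
  (L <= P)%VS -> sect K L != 2.
Proof.
move=> cK evq dP sP t1 t2 l1P l2P zl1 zl2 l12 lL zL LP; apply/negP => /eqP sL.
have oP : odd (sect K P) by rewrite sP oddD addbT evq.
have zK : z \notin K.
  apply/negP => zK; have := arc_two_tangents_le cK dP t1 t2 l1P l2P zK zl1 zl2 l12.
  by rewrite sP addn1 ltnn.
pose A := points_on L :\: K; pose B := (K :&: points_on P) :\: points_on L.
have inA x : x \in A = (x <= L)%VS && (x \notin K) by rewrite !inE andbC.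
have inB k : k \in B = [&& k \in K, (k <= P)%VS & ~~ (k <= L)%VS].
  by rewrite !inE andbC andbA.
have tangentB l x : tangent K l -> (x <= l)%VS -> (l <= P)%VS -> x \in A ->
    exists2 k, k \in B & l = (k + x)%VS.
  move=> tl xl lP; rewrite inA => /andP[xL xK]; have [k kK kl] := tangent_contact tl.
  have kx : k != x by apply: contraNneq xK => <-.
  have e := line_join (tangent_line tl) kl xl kx; exists k => //.
  rewrite inB kK (subv_trans kl lP) /=; apply/negP => kL.
  by apply: (secant_not_tangent sL); rewrite -(line_join lL kL xL kx) e.
have cardAB : #|B| <= #|A|.
  have eA : #|A| + 2 = q + 1.
    have := cardsID K (points_on L); rewrite setIC -/(sect K L) sL.
    by rewrite (card_points_line (eqP lL)) -/A addnC addn1.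
  have eB : #|B| + 2 = q + 1.
    have := cardsID (points_on L) (K :&: points_on P); rewrite -/(sect K P) sP -/B.
    have -> : K :&: points_on P :&: points_on L = K :&: points_on L.
      apply/setP => x; rewrite !inE; case xL: (x <= L)%VS; rewrite ?andbF // andbT.
      by rewrite (subv_trans xL LP) andbT.
    by rewrite -/(sect K L) sL addnC.
  by rewrite -(leq_add2r 2) eA eB.
have zA : z \in A by rewrite inA zL.
have [k1 k1B e1] := tangentB _ _ t1 zl1 l1P zA.
have [k2 k2B e2] := tangentB _ _ t2 zl2 l2P zA.
suff k12 : k1 = k2 by move: l12; rewrite e1 e2 k12 eqxx.
apply: (@matching_unique _ _ A B (fun k x => tangent K (k + x)) _ _ cardAB z) => //.
- move=> x xA; have /andP[xL xK] : (x <= L)%VS && (x \notin K) by rewrite -inA.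
  have [l [tl xl lP]] := odd_section_tangent cK dP oP (subv_trans xL LP) xK.
  by have [k kB e] := tangentB _ _ tl xl lP xA; exists k; rewrite // -e.
- move=> k x y; rewrite inB !inA => /and3P[kK kP kL] /andP[xL xK] /andP[yL yK] tx ty.
  apply/eqP/negPn/negP => xy.
  have sub w : (w <= L)%VS -> (k + w <= P)%VS.
    by move=> wL; rewrite subv_add kP (subv_trans wL LP).
  have ne : (k + x)%VS != (k + y)%VS.
    apply: contra kL => /eqP e; rewrite -(line_join lL xL yL xy).
    rewrite (line_join (tangent_line tx)) ?addvSl ?addvSr //.
    by rewrite e addvSr.
  have := arc_two_tangents_le cK dP tx ty (sub _ xL) (sub _ yL) kK _ _ ne.
  by rewrite !addvSl sP addn1 ltnn => /(_ isT isT).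
- by rewrite -e1.
- by rewrite -e2.
Qed.

(** No line through [z] is a secant, so the [q + 1] points of the oval lie on the
    [q + 1] lines through [z], one on each. *)
Lemma two_tangents_nucleus K P l1 l2 z l : cap K -> ~~ odd q -> \dim P = 3 ->
  sect K P = q + 1 -> tangent K l1 -> tangent K l2 -> (l1 <= P)%VS -> (l2 <= P)%VS ->
  (z <= l1)%VS -> (z <= l2)%VS -> l1 != l2 -> is_line l -> (z <= l)%VS ->
  (l <= P)%VS -> tangent K l.
Proof.
move=> cK evq dP sP t1 t2 l1P l2P zl1 zl2 l12 ll zl lP.
have nosec l' := two_tangents_no_secant cK evq dP sP t1 t2 l1P l2P zl1 zl2 l12 (L := l').
have zP := subv_trans zl lP.
have zK : z \notin K.
  apply/negP => zK; have := arc_two_tangents_le cK dP t1 t2 l1P l2P zK zl1 zl2 l12.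
  by rewrite sP addn1 ltnn.
have le1 l' : between z P l' -> sect K l' <= 1.
  by move=> /between_line[ll' zl' l'P]; move: (nosec _ ll' zl' l'P) (cK _ ll'); arith.
apply: tangentI => //; have := pencil_le1 zP le1 (line_between ll zl lP).
have := le1 _ (line_between ll zl lP).
by rewrite card_lines_in_plane // sect_point (negPf zK) sP; arith.
Qed.

End Caps.

(** * The bound on the size of caps *)

Section LargeCaps.
Variable F : finFieldType.
Local Notation V := 'rV[F]_4.
Local Notation q := #|F|.
Implicit Types (K : {set point F}) (S T U P Q l L : {vspace V}).
Implicit Types (p x y z k N : point F).
Hypothesis q_even : ~~ odd q.
Hypothesis q_gt2 : 2 < q.

Lemma tangent_plane_le K l : cap K -> tangent K l ->
  forall Q, between l fullv Q -> sect K Q <= q + 1.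
Proof.
move=> cK tl Q /(between_plane (tangent_line tl))[dQ lQ].
exact: arc_tangent_le tl lQ.
Qed.

(** The [q + 1] planes through [l] share at least [q^2] points off [l], and each
    has at most [q] of them. *)
Lemma oval_plane_on_tangent K l : cap K -> q ^ 2 + 1 <= #|K| -> tangent K l ->
  exists P, [/\ \dim P = 3, (l <= P)%VS & sect K P = q + 1].
Proof.
move=> cK leK tl; have ll := tangent_line tl.
case: (boolP [exists x in dirs fullv l, sect K (l + x) == q + 1]).
  move=> /exists_inP[x xd /eqP e].
  have [dP lP] := between_plane ll (between_dir (subvf l) xd).
  by exists (l + x)%VS.
move=> /exists_inPn h; have le U : between l fullv U -> sect K U <= q.
  move=> bU; have := tangent_plane_le cK tl bU.
  by have [x xd <-] := dir_between bU; move: (h x xd); arith.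
have := pencil_le (subvf l) le.
rewrite sect_full card_planes_on_line // (tangent_sect tl).
by move: leK; arith.
Qed.

Definition nucleus K P N :=
  (N <= P)%VS /\ forall l, is_line l -> (N <= l)%VS -> (l <= P)%VS -> tangent K l.

(** The tangent [l] and the tangent at any other point of the oval meet in [N]. *)
Lemma nucleus_exists K P l : cap K -> \dim P = 3 -> sect K P = q + 1 ->
  tangent K l -> (l <= P)%VS -> exists N, [/\ nucleus K P N, N \notin K & (N <= l)%VS].
Proof.
move=> cK dP sP tl lP; have [p pK pl] := tangent_contact tl.
have [k [kK kP kp]] : exists k, [/\ k \in K, (k <= P)%VS & k != p].
  by apply: sect_gt1P; rewrite sP; move: q_gt2; arith.
have [l' [tl' kl' l'P]] := tangent_at cK dP (eq_leq sP) kK kP.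
have ne : l != l'.
  apply: contraNneq kp => e; apply/eqP.
  by apply: (contact_uniq (tangent_sect tl)) => //; rewrite e.
have d1 : 0 < \dim (l :&: l').
  have := dimv_sum_cap l l'; rewrite (eqP (tangent_line tl)) (eqP (tangent_line tl')).
  have : (l + l' <= P)%VS by rewrite subv_add lP.
  by move=> /dimvS; rewrite dP; arith.
have d0 : \dim (0 : {vspace V}) <= 0 by rewrite dimv0.
have [N] := point_in_ge d1 d0; rewrite subv_cap => /andP[Nl Nl'] _.
exists N; split=> //.
  split=> [|l0 ll0 Nl0 l0P]; first exact: subv_trans lP.
  exact: (two_tangents_nucleus cK q_even dP sP tl tl' lP l'P Nl Nl' ne).
apply/negP => NK; move: kp.
rewrite -(contact_uniq (tangent_sect tl) NK Nl pK pl).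
by rewrite -(contact_uniq (tangent_sect tl') NK Nl' kK kl') eqxx.
Qed.

(** A section that has a tangent is no hyperoval; the tangents through the nucleus
    of one oval plane thus bound by [q + 1] the sections of all planes through it. *)
Lemma nucleus_plane K P N Q : \dim P = 3 -> nucleus K P N ->
  \dim Q = 3 -> (N <= Q)%VS ->
  exists l, [/\ tangent K l, (N <= l)%VS, (l <= P)%VS & (l <= Q)%VS].
Proof.
move=> dP [NP nuc] dQ NQ; have [l [ll Nl lP lQ]] := meet_line_in_plane dP dQ NP NQ.
by exists l; split=> //; apply: nuc.
Qed.

Lemma nucleus_plane_le K P N L : cap K -> \dim P = 3 -> nucleus K P N ->
  (N <= L)%VS -> is_line L -> forall Q, between L fullv Q -> sect K Q <= q + 1.
Proof.
move=> cK dP nuc NL lL Q /(between_plane lL)[dQ LQ].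
have [l [tl _ _ lQ]] := nucleus_plane dP nuc dQ (subv_trans NL LQ).
exact: arc_tangent_le tl lQ.
Qed.

Lemma nucleus_secant_card K P N L : cap K -> \dim P = 3 -> nucleus K P N ->
  (N <= L)%VS -> is_line L -> sect K L = 2 -> #|K| <= q ^ 2 + 1.
Proof.
move=> cK dP nuc NL lL sL.
have := pencil_le (subvf L) (nucleus_plane_le cK dP nuc NL lL).
by rewrite sect_full sL card_planes_on_line //; arith.
Qed.

Lemma nucleus_secant_plane K P N L Q : cap K -> #|K| = q ^ 2 + 1 -> \dim P = 3 ->
  nucleus K P N -> (N <= L)%VS -> is_line L -> sect K L = 2 -> \dim Q = 3 ->
  (L <= Q)%VS -> sect K Q = q + 1.
Proof.
move=> cK eK dP nuc NL lL sL dQ LQ.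
have bQ := plane_between lL dQ LQ.
have le := nucleus_plane_le cK dP nuc NL lL; have := le _ bQ.
have := pencil_le1 (subvf L) le bQ.
by rewrite sect_full eK sL card_planes_on_line //; arith.
Qed.

Lemma cap_add K N : cap K ->
  (forall L, is_line L -> (N <= L)%VS -> sect K L != 2) -> cap (N |: K).
Proof.
move=> cK nosec l ll.
have : sect (N |: K) l <= sect K l + (N <= l)%VS.
  case Nl: (N <= l)%VS; last first.
    rewrite addn0; apply/subset_leq_card/subsetP => x.
    by rewrite !inE => /andP[/orP[/eqP->|->]]; rewrite ?Nl.
  rewrite addn1 -[_.+1]add1n.
  apply: leq_trans (_ : #|N |: (K :&: points_on l)| <= _); last first.
    by rewrite cardsU1 leq_add2r; case: (_ \notin _).
  apply/subset_leq_card/subsetP => x; rewrite !inE.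
  by case: (x == N) => //= /andP[-> ->].
case Nl: (N <= l)%VS; last by move: (cK l ll); arith.
by move: (cK l ll) (nosec l ll Nl); arith.
Qed.

Lemma cap_card_le K : cap K -> #|K| <= q ^ 2 + q + 2.
Proof.
move=> cK; case: (posnP #|K|) => [->//|/card_gt0P[p pK]].
have := pencil_le (subvf p) (@cap_between_le2 _ _ _ _ cK).
by rewrite sect_full sect_point pK card_lines_on_point; arith.
Qed.

(** A cap without tangents has [q^2 + q + 2] points, planes meet it in [0] or
    [q + 2] points and some line misses it; the planes through this line then show
    that [q + 2] divides [q^2 + q + 2], hence [4]. *)
Lemma tangent_of_cap K : cap K -> 0 < #|K| -> exists l, tangent K l.
Proof.
move=> cK /card_gt0P[p pK].
case: (boolP [exists k in K, [exists x in dirs fullv k, tangent K (k + x)]]).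
  by move=> /exists_inP[k _ /exists_inP[x _ t]]; exists (k + x)%VS.
move=> /exists_inPn h.
have lt2 l : is_line l -> sect K l < 2 -> sect K l = 0.
  move=> ll lt; apply/eqP; rewrite -leqn0 leqNgt; apply/negP => gt.
  have [k kK kl] := sect_gt0P K l gt.
  have [x xd e] := dir_between (line_between ll kl (subvf l)).
  have /exists_inPn/(_ x xd)/negP[] := h k kK; rewrite e.
  by apply: tangentI => //; move: gt lt; arith.
have card_K : #|K| = q ^ 2 + q + 2.
  apply/eqP; rewrite eqn_leq cap_card_le //= leqNgt; apply/negP => lt.
  have [|l /between_line[ll pl _] /(lt2 _ ll) e] := @pencil_lt _ K p fullv 2 (subvf p).
    by rewrite sect_full sect_point pK card_lines_on_point; move: lt; arith.
  by have := sect_gt0 pK pl; rewrite e.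
have planes P : \dim P = 3 -> 0 < sect K P -> sect K P = q + 2.
  move=> dP /sect_gt0P[k kK kP].
  apply/eqP; rewrite eqn_leq arc_le //= leqNgt; apply/negP => lt.
  have [|l /between_line[ll pl _] /(lt2 _ ll) e] := @pencil_lt _ K k P 2 kP.
    by rewrite sect_point kK card_lines_in_plane //; move: lt; arith.
  by have := sect_gt0 kK pl; rewrite e.
have [z zK] : exists z, z \notin K.
  apply/existsP; rewrite -negb_forall; apply/negP => /forallP allK.
  have : #|{: point F}| <= #|K| by apply/subset_leq_card/subsetP => x _; apply: allK.
  by rewrite card_point card_K; move: q_gt2; narith.
have zp : z != p by apply: contraNneq zK => ->.
have [P dP /andP[zP pP]] : exists2 P, \dim P = 3 & (z <= P)%VS && (p <= P)%VS.
  have d4 : 2 < \dim {:V} by rewrite dim_full.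
  have [y _ yl] := point_in_ge d4 (eq_leq (join_line zp)).
  exists (z + p + y)%VS; first by rewrite (dim_join yl) join_line.
  by rewrite !(subv_trans _ (addvSl _ y)) ?addvSl ?addvSr.
have [|l /between_line[ll zl lP] /(lt2 _ ll) sl] := @pencil_lt _ K z P 2 zP.
  rewrite sect_point (negPf zK) card_lines_in_plane // planes //.
    by move: q_gt2; arith.
  exact: sect_gt0 pK pP.
have : q + 2 %| #|K|.
  have := pencil_sum K (subvf l); rewrite sl sect_full muln0 !addn0 => <-.
  apply: dvdn_sum => x xd.
  have [dQ _] := between_plane ll (between_dir (subvf l) xd).
  by case: (posnP (sect K (l + x))) => [->|/(planes _ dQ)->]; rewrite ?dvdn0.
have -> : #|K| = (q + 2) * q.-1 + 4 by rewrite card_K; move: q_gt2; narith.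
rewrite dvdn_addr ?dvdn_mulr // => /dvdn_leq; move: q_gt2; arith.
Qed.

(** If no secant passes through a nucleus, then adding it yields a cap.  As long as
    a cap has more than [q^2 + 1] points this is the case, so such a cap could be
    extended beyond the [q^2 + q + 2] points of [cap_card_le]. *)
Lemma cap_bound K : cap K -> #|K| <= q ^ 2 + 1.
Proof.
move=> cK; have [n] : exists n, q ^ 2 + q + 2 <= #|K| + n.
  by exists (q ^ 2 + q + 2); exact: leq_addl.
elim: n K cK => [|n IH] K cK le; rewrite leqNgt; apply/negP => gt;
  have [|l tl] := tangent_of_cap cK; try (by apply: leq_trans gt);
  have [P [dP lP sP]] := oval_plane_on_tangent cK (ltnW gt) tl;
  have [N [nuc NK _]] := nucleus_exists cK dP sP tl lP;
  (have cNK : cap (N |: K); first by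
    apply: cap_add => // L lL NL; apply/eqP => sL;
    have := nucleus_secant_card cK dP nuc NL lL sL; rewrite leqNgt gt);
  have eNK : #|N |: K| = #|K|.+1 by rewrite cardsU1 NK.
  by have := cap_card_le cNK; rewrite eNK; move: le; arith.
have := IH _ cNK; rewrite eNK; move: gt le; arith.
Qed.

End LargeCaps.

(** * The star of a point with respect to an ovoid *)

Section OvoidStars.
Variable F : finFieldType.
Local Notation V := 'rV[F]_4.
Local Notation q := #|F|.
Implicit Types (S T U P Q l L : {vspace V}).
Implicit Types (p x y z k N : point F).
Hypothesis q_even : ~~ odd q.
Hypothesis q_gt2 : 2 < q.
Variable O : {set point F}.
Hypothesis cO : cap O.
Hypothesis eO : #|O| = q ^ 2 + 1.

Lemma secant_through z : z \notin O ->
  exists L, [/\ is_line L, (z <= L)%VS & sect O L = 2].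
Proof.
move=> zO; case: (boolP [exists x in dirs fullv z, sect O (z + x) == 2]).
  move=> /exists_inP[x xd /eqP e].
  have /between_line[ll zl _] := between_dir (subvf z) xd.
  by exists (z + x)%VS.
move=> /exists_inPn h; have czO : cap (z |: O).
  apply: cap_add => // L lL zL.
  by have [x xd <-] := dir_between (line_between lL zL (subvf L)); apply: h.
have := cap_bound q_even q_gt2 czO; rewrite cardsU1 zO eO; arith.
Qed.

Lemma tangent_on p : p \in O -> exists2 l, tangent O l & (p <= l)%VS.
Proof.
move=> pO; have [|l /between_line[ll pl _] lt] := @pencil_lt _ O p fullv 2 (subvf p).
  by rewrite sect_full eO sect_point pO card_lines_on_point; move: q_gt2; narith.
by exists l => //; apply: tangentI => //; move: lt (sect_gt0 pO pl); arith.
Qed.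

(** The planes through a tangent [l] contain the nucleus [N] of an oval plane on
    [l], and this leaves them only [1] or [q + 1] points; not all of them can have
    [q + 1], as they share [q^2] points off [l]. *)
Lemma tangent_plane p : p \in O ->
  exists P, [/\ \dim P = 3, (p <= P)%VS & sect O P = 1].
Proof.
move=> pO; have [l tl pl] := tangent_on pO; have ll := tangent_line tl.
have leO : q ^ 2 + 1 <= #|O| by rewrite eO.
have [P [dP lP sP]] := oval_plane_on_tangent cO leO tl.
have [N [nuc NO Nl]] := nucleus_exists q_even q_gt2 cO dP sP tl lP.
have [L [lL NL sL]] := secant_through NO.
have NP : (N <= P)%VS by case: nuc.
have oval Q : \dim Q = 3 -> (l <= Q)%VS -> 1 < sect O Q -> sect O Q = q + 1.
  move=> dQ lQ /(sect_gt1P p)[r [rO rQ rp]].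
  have NQ := subv_trans Nl lQ.
  have Nr : N != r by apply: contraNneq NO => ->.
  have rl : ~~ (r <= l)%VS.
    by apply: contra rp => rl; apply/eqP/(contact_uniq (tangent_sect tl)).
  have lNr := is_line_join Nr.
  have [rP|rP] := boolP (r <= P)%VS.
    suff -> : Q = P by [].
    have d3 : \dim (l + r) = 3 by rewrite (dim_join rl) (eqP ll).
    have eqlr R : \dim R = 3 -> (l <= R)%VS -> (r <= R)%VS -> (l + r)%VS = R.
      by move=> dR lR rR; apply/eqP; rewrite eqEdim subv_add lR rR dR d3.
    by rewrite -(eqlr Q) // (eqlr P).
  have [sNr|sNr] := eqVneq (sect O (N + r)) 2.
    apply: (nucleus_secant_plane cO eO dP nuc (addvSl N r) lNr sNr dQ).
    by rewrite subv_add NQ.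
  have tNr := not_secant_tangent cO lNr (sect_gt0 rO (addvSr N r)) sNr.
  have ne : L != (N + r)%VS by apply: contraNneq sNr => <-; rewrite sL.
  have dQ' := dim_join_lines lL lNr NL (addvSl N r) ne.
  have sQ' := nucleus_secant_plane cO eO dP nuc NL lL sL dQ' (addvSl _ _).
  have NQ' : (N <= L + (N + r))%VS := subv_trans NL (addvSl _ _).
  have [l' [tl' Nl' l'P l'Q']] := nucleus_plane dP nuc dQ' NQ'.
  have ne' : (N + r)%VS != l'.
    by apply: contraNneq rP => e; rewrite (subv_trans _ l'P) // -e addvSr.
  (* Two tangents through [N] in the oval plane on [L] and [r] would make the
     secant [L] a tangent. *)
  exfalso; apply: (secant_not_tangent sL).
  exact: (two_tangents_nucleus cO q_even dQ' sQ' tNr tl' (addvSr _ _) l'Q'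
            (addvSl N r) Nl' ne' lL NL (addvSl _ _)).
have [|Q /(between_plane ll)[dQ lQ] lt] := @pencil_lt _ O l fullv (q + 1) (subvf l).
  rewrite sect_full eO card_planes_on_line // (tangent_sect tl).
  by move: q_gt2; narith.
exists Q; split=> //; first exact: subv_trans lQ.
have gt := sect_gt0 pO (subv_trans pl lQ).
have := oval Q dQ lQ; move: lt gt; case: (sect O Q) => [|[|m]] // lt _ /(_ isT) e.
by move: lt; rewrite e ltnn.
Qed.

(** A plane through a tangent at [p] outside [P] meets [P] in another tangent at
    [p], so it has at most [q] points; such planes are too poor to cover [O]. *)
Lemma tangent_in_tangent_plane p P l : p \in O -> \dim P = 3 -> (p <= P)%VS ->
  sect O P = 1 -> is_line l -> (p <= l)%VS -> tangent O l = (l <= P)%VS.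
Proof.
move=> pO dP pP sP ll pl; apply/idP/idP => [tl|lP]; last first.
  apply: tangentI => //; apply/eqP; rewrite eqn_leq (sect_gt0 pO pl) andbT.
  by rewrite -sP; apply: sectS.
apply/negPn/negP => lP.
have le Q : between l fullv Q -> sect O Q <= q.
  move=> /(between_plane ll)[dQ lQ].
  have [l' [ll' pl' l'P l'Q]] := meet_line_in_plane dP dQ pP (subv_trans pl lQ).
  have tl' : tangent O l'.
    apply: tangentI => //; apply/eqP; rewrite eqn_leq (sect_gt0 pO pl') andbT.
    by rewrite -sP; apply: sectS.
  have ne : l != l' by apply: contraNneq lP => ->.
  exact: (arc_two_tangents_le cO dQ tl tl' lQ l'Q pO pl pl').
have := pencil_le (subvf l) le.
by rewrite sect_full eO card_planes_on_line // (tangent_sect tl); arith.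
Qed.

(** On the line where [Q] meets the tangent plane at one of its points, the tangent
    plane has a single point, which forces [q + 1] on the [q] other planes. *)
Lemma oval_plane Q : \dim Q = 3 -> 1 < sect O Q -> sect O Q = q + 1.
Proof.
move=> dQ s1; have [p pO pQ] := sect_gt0P O Q (ltnW s1).
have [P [dP pP sP]] := tangent_plane pO.
have [l [ll pl lP lQ]] := meet_line_in_plane dP dQ pP pQ.
have tl : tangent O l by rewrite (tangent_in_tangent_plane pO dP).
have le := tangent_plane_le cO tl.
have ne : P != Q by apply: contraTneq s1 => <-; rewrite sP.
have := pencil_le2 (subvf l) le (plane_between ll dP lP) (plane_between ll dQ lQ) ne.
have := le _ (plane_between ll dQ lQ).
by rewrite sect_full eO card_planes_on_line // (tangent_sect tl) sP; arith.
Qed.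

(** The polar plane of [z] in the polarity whose totally isotropic lines are the
    tangents of [O]. *)
Definition is_star z R :=
  [/\ \dim R = 3, (z <= R)%VS &
      forall l, is_line l -> (z <= l)%VS -> tangent O l = (l <= R)%VS].

(** Two planes on a secant through [z] give two tangents through [z], and [z] is
    the nucleus of the plane that they span. *)
Lemma star_exists z : exists R, is_star z R.
Proof.
have [zO|zO] := boolP (z \in O).
  have [P [dP pP sP]] := tangent_plane zO.
  by exists P; split=> // l ll zl; apply: (tangent_in_tangent_plane zO).
have [L [lL zL sL]] := secant_through zO.
have oval Q : \dim Q = 3 -> (L <= Q)%VS -> sect O Q = q + 1.
  by move=> dQ LQ; apply: oval_plane => //; rewrite -sL; apply: sectS.
have tan Q : \dim Q = 3 -> (L <= Q)%VS ->
    exists l, [/\ tangent O l, (z <= l)%VS & (l <= Q)%VS].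
  move=> dQ LQ; apply: odd_section_tangent => //; last exact: subv_trans LQ.
  by rewrite (oval Q) // oddD addbT q_even.
have planes2 : exists Q Q', [/\ \dim Q = 3, \dim Q' = 3, (L <= Q)%VS, (L <= Q')%VS
    & forall l, is_line l -> (l <= Q)%VS -> (l <= Q')%VS -> l = L].
  have d2 : 2 < \dim {:V} by rewrite dim_full.
  have [y _ yL] := point_in_ge d2 (eq_leq (eqP lL)).
  have dQ : \dim (L + y) = 3 by rewrite (dim_join yL) (eqP lL).
  have d3 : 3 < \dim {:V} by rewrite dim_full.
  have [y' _ y'Q] := point_in_ge d3 (eq_leq dQ).
  have y'L : ~~ (y' <= L)%VS.
    by apply: contra y'Q => /subv_trans; apply; exact: addvSl.
  have dQ' : \dim (L + y') = 3 by rewrite (dim_join y'L) (eqP lL).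
  exists (L + y)%VS, (L + y')%VS; split; rewrite ?addvSl // => l ll lQ lQ'.
  apply/eqP; rewrite eqEdim (eqP ll) (eqP lL) leqnn andbT.
  apply/negPn/negP => lL'.
  have [w wl wL] := point_notin lL'.
  case/negP: y'Q; rewrite -(join_exchange (subv_trans wl lQ) wL).
  by rewrite (join_exchange (subv_trans wl lQ') wL) addvSr.
have [Q1 [Q2 [dQ1 dQ2 LQ1 LQ2 meet]]] := planes2.
have [l1 [t1 zl1 l1Q]] := tan Q1 dQ1 LQ1.
have [l2 [t2 zl2 l2Q]] := tan Q2 dQ2 LQ2.
have ne : l1 != l2.
  apply/negP => /eqP e; apply: (secant_not_tangent sL).
  by rewrite -(meet l1 (tangent_line t1)) // e.
have dR := dim_join_lines (tangent_line t1) (tangent_line t2) zl1 zl2 ne.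
have oR : sect O (l1 + l2) = q + 1.
  apply: oval_plane => //.
  have [k1 k1O k1l] := tangent_contact t1; have [k2 k2O k2l] := tangent_contact t2.
  apply: (sect_gt1 k1O (subv_trans k1l (addvSl _ _)) k2O (subv_trans k2l (addvSr _ _))).
  apply: contraNneq ne => e; rewrite -e in k2l.
  have zk : z != k1 by apply: contraNneq zO => ->.
  rewrite -(line_join (tangent_line t1) zl1 k1l zk).
  by rewrite (line_join (tangent_line t2) zl2 k2l zk).
exists (l1 + l2)%VS; split=> //; first exact: subv_trans (addvSl _ _).
move=> l ll zl; apply/idP/idP => [tl|lR]; last first.
  exact: (two_tangents_nucleus cO q_even dR oR t1 t2 (addvSl _ _) (addvSr _ _)
            zl1 zl2 ne ll zl lR).
apply/negPn/negP => lR.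
have neL : L != l by apply/negP => /eqP e; apply: (secant_not_tangent sL); rewrite e.
have dQ := dim_join_lines lL ll zL zl neL.
have sQ := oval _ dQ (addvSl _ _).
have zR : (z <= l1 + l2)%VS := subv_trans zl1 (addvSl _ _).
have [l' [ll' zl' l'R l'Q]] :=
  meet_line_in_plane dR dQ zR (subv_trans zL (addvSl L l)).
have tl' : tangent O l'.
  exact: (two_tangents_nucleus cO q_even dR oR t1 t2 (addvSl _ _) (addvSr _ _)
            zl1 zl2 ne ll' zl' l'R).
have ne' : l != l' by apply: contraNneq lR => ->.
apply: (secant_not_tangent sL).
exact: (two_tangents_nucleus cO q_even dQ sQ tl tl' (addvSr _ _) l'Q zl zl' ne' lL zL
          (addvSl _ _)).
Qed.

End OvoidStars.

(** * Stars and the symplectic form *)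

Section LinearAlgebra.
Local Open Scope ring_scope.
Variable F : finFieldType.
Local Notation V := 'rV[F]_4.
Hypothesis pchar2 : 2 \in [pchar F].

(** The Frobenius automorphism is injective on a finite set. *)
Lemma sqrt_pchar2 (x : F) : exists t, t ^+ 2 = x.
Proof.
have inj : injective (pFrobenius_aut pchar2) by apply: fmorph_inj.
have [g _ gK] := injF_bij inj.
by exists (g x); rewrite -(pFrobenius_autE pchar2) gK.
Qed.

Variable B : {skew_symmetric V}.
Hypothesis sB : is_psymplectic B.

Lemma form_alt u : B u u = 0.
Proof. by have [_ _] := sB; apply. Qed.

Lemma form_nondeg u : (forall v, B u v = 0) -> u = 0.
Proof.
move=> h; have [/eqP rad0 _ _] := sB; apply/eqP; rewrite -memv0 -rad0.
by apply/mem_orthovP => v _; apply: h.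
Qed.

Lemma form_sym0 u v : B u v = 0 -> B v u = 0.
Proof. by move=> h; apply/eqP; rewrite herm_eq0C h. Qed.

Lemma dim_orthov_vec (u : V) : u != 0 -> \dim (orthov B <[u]>) = 3%N.
Proof.
move=> u0; have : u \notin orthov B fullv.
  apply/negP => /mem_orthovP h; case/eqP: u0; apply: form_nondeg => v.
  by apply: h; rewrite memvf.
by move=> /eq_dim_orthov1; rewrite capfv dim_full.
Qed.

Lemma dim_span2 (u v : V) : u != 0 -> v \notin <[u]>%VS ->
  \dim (<[u]> + <[v]>) = 2%N.
Proof.
move=> u0 vu; have v0 : v != 0 by apply: contraNneq vu => ->; rewrite mem0v.
have := @dim_join _ <[u]>%VS (vec_point v0); rewrite -memvE => /(_ vu) ->.
by rewrite dim_vline u0.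
Qed.

Lemma span2 (S : {vspace V}) u v : \dim S = 2%N -> u \in S -> v \in S ->
  u != 0 -> v \notin <[u]>%VS -> S = (<[u]> + <[v]>)%VS.
Proof.
move=> dS uS vS u0 vu; apply/eqP.
by rewrite eq_sym eqEdim subv_add -!memvE uS vS dS dim_span2.
Qed.

Lemma dim_orthov_line m : \dim m = 2%N -> ~~ (m <= orthov B m)%VS ->
  \dim (orthov B m) = 2%N.
Proof.
move=> dm /subvPn[u um /mem_orthovPn[u' u'm buu']].
have u0 : u != 0 by apply: contraNneq buu' => ->; rewrite linear0l.
have u'u : u' \notin <[u]>%VS.
  by apply: contra buu' => /vlineP[k ->]; rewrite linearZr /= form_alt mulr0.
have em := span2 dm um u'm u0 u'u.
have -> : orthov B m = (orthov B <[u]> :&: orthov B <[u']>)%VS.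
  apply/vspaceP => w; rewrite memv_cap.
  by rewrite !mem_orthov_sym -subv_add -em.
have u'o : u' \notin orthov B (orthov B <[u]>).
  apply/mem_orthovPn; exists u; first by rewrite mem_orthov1 form_alt.
  by apply: contraNneq buu' => /form_sym0->.
by have := eq_dim_orthov1 u'o; rewrite dim_orthov_vec // => <-.
Qed.


Lemma add2P (u v w : V) : w \in (<[u]> + <[v]>)%VS ->
  exists a b, w = a *: u + b *: v.
Proof.
by move=> /memv_addP[_ /vlineP[a ->] [_ /vlineP[b ->] ->]]; exists a, b.
Qed.

Lemma orthov_complement m : \dim m = 2%N -> ~~ (m <= orthov B m)%VS ->
  (m + orthov B m)%VS = fullv.
Proof.
move=> dm nm; have dn := dim_orthov_line dm nm.
have /subvPn[u um /mem_orthovPn[u' u'm buu']] := nm.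
have u0 : u != 0 by apply: contraNneq buu' => ->; rewrite linear0l.
have u'u : u' \notin <[u]>%VS.
  by apply: contra buu' => /vlineP[k ->]; rewrite linearZr /= form_alt mulr0.
have cap0 : (m :&: orthov B m)%VS = 0%VS.
  apply/eqP; rewrite -subv0; apply/subvP => x; rewrite memv_cap memv0.
  rewrite {1}(span2 dm um u'm u0 u'u) => /andP[/add2P[a [b ->]] /mem_orthovP xn].
  have := xn _ um; have := xn _ u'm.
  rewrite !linearDl !linearZl_LR /= !form_alt !mulr0 addr0 add0r.
  move=> /eqP; rewrite mulf_eq0 (negPf buu') orbF => /eqP->.
  move=> /eqP; rewrite mulf_eq0 orbC herm_eq0C (negPf buu') /= => /eqP->.
  by rewrite !scale0r addr0.
apply/eqP; rewrite eqEdim subvf /= dimv_disjoint_sum // dm dn.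
by have := dim_full F; rewrite /= => ->.
Qed.

Variable star : V -> {vspace V}.
Hypothesis star_sym : forall v w, (w \in star v) = (v \in star w).
Hypothesis star_id : forall v, v \in star v.
Hypothesis star_dim : forall v, v != 0 -> \dim (star v) = 3%N.

Lemma star_meets (v : V) (S : {vspace V}) : \dim S = 2%N ->
  exists w, [/\ w != 0, w \in S & w \in star v].
Proof.
move=> dS; suff : (S :&: star v)%VS != 0%VS.
  move=> S0; exists (vpick (S :&: star v)); rewrite vpick0.
  by have := memv_pick (S :&: star v)%VS; rewrite memv_cap => /andP[].
have [->|v0] := eqVneq v 0.
  have -> : (S :&: star 0)%VS = S.
    by apply/capv_idPl/subvP => w _; rewrite star_sym mem0v.
  by rewrite -dimv_eq0 dS.
rewrite -dimv_eq0; have := dimv_sum_cap S (star v); have := dimvS (subvf (S + star v)%VS).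
by rewrite dim_full dS star_dim //; arith.
Qed.

Lemma memvZ_eq (S : {vspace V}) (a : F) (w : V) : a != 0 -> (a *: w \in S) = (w \in S).
Proof. by move=> a0; rewrite rpredZeq (negPf a0). Qed.

(** Choose [v] and [v'] in the perp [n] of [m] so that, for the stars, [u] is
    perpendicular to [v] and [u'] to [v'].  Then [star (u + t v)] contains [u], [v]
    and [u' - h t v'] for a constant [h], whereas the perp of [u + t v] contains
    [u], [v] and [u' - s v'] with [t s] constant; the two agree for a suitable
    value of [t^2]. *)
Lemma star_meets_orthov m : \dim m = 2%N -> ~~ (m <= orthov B m)%VS ->
  (forall u, u \in m -> (m <= star u)%VS) ->
  (forall u, u \in orthov B m -> (orthov B m <= star u)%VS) ->
  exists2 z, z != 0 & star z = orthov B <[z]>%VS.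
Proof.
set n := orthov B m => dm nm iso_m iso_n.
have dn : \dim n = 2%N by apply: dim_orthov_line.
have Bmn u v : u \in m -> v \in n -> B v u = 0.
  by move=> um /mem_orthovP; apply.
have /subvPn[u um /mem_orthovPn[u' u'm buu']] := nm.
have u0 : u != 0 by apply: contraNneq buu' => ->; rewrite linear0l.
have u'u : u' \notin <[u]>%VS.
  by apply: contra buu' => /vlineP[k ->]; rewrite linearZr /= form_alt mulr0.
have em := span2 dm um u'm u0 u'u.
have u'0 : u' != 0 by apply: contraNneq u'u => ->; rewrite mem0v.
have sum_mn : (m + n)%VS = fullv by apply: orthov_complement.
have not_full v : v != 0 -> (m <= star v)%VS -> (n <= star v)%VS -> False.
  move=> v0 mv nv; have : (fullv <= star v)%VS by rewrite -sum_mn subv_add mv.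
  by move=> /dimvS; rewrite star_dim // dim_full.
have [v [v0 vn vu]] := star_meets u dn.
have [v' [v'0 v'n v'u']] := star_meets u' dn.
have v'u : v' \notin star u.
  apply/negP => v'u; apply: (not_full v' v'0); last exact: iso_n.
  by rewrite em subv_add -!memvE (star_sym v' u) v'u (star_sym v' u') v'u'.
have vu' : v \notin star u'.
  apply/negP => vu'; apply: (not_full v v0); last exact: iso_n.
  by rewrite em subv_add -!memvE (star_sym v u) vu (star_sym v u') vu'.
have v'v : v' \notin <[v]>%VS.
  apply: contra vu' => /vlineP[k ev]; move: v'0 v'u'; rewrite ev.
  by rewrite scaler_eq0 negb_or => /andP[k0 _]; rewrite memvZ_eq.
have en := span2 dn vn v'n v0 v'v.
have bvv' : B v v' != 0.
  apply: contra v0 => /eqP bvv'; apply/eqP/form_nondeg => w.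
  have : w \in (m + n)%VS by rewrite sum_mn memvf.
  move=> /memv_addP[x xm [y yn ->]]; rewrite linearDr /= (Bmn _ _ xm vn) add0r.
  move: yn; rewrite en => /add2P[a [b ->]].
  by rewrite linearDr !linearZr /= form_alt bvv' !mulr0 addr0.
have v'_v : v \in star v' by rewrite (subvP (iso_n _ v'n)).
have u'_u : u \in star u' by rewrite (subvP (iso_m _ u'm)).
have [h h0 yh] : exists2 h, h != 0 & u' + h *: u \in star (v' + v).
  have [w [w0 wm wy]] := star_meets (v' + v) dm.
  move: wm w0 wy; rewrite em => /add2P[a [b ->]] w0 wy.
  have b0 : b != 0.
    apply: contraNneq v'u => b0; move: w0 wy; rewrite b0 scale0r addr0.
    rewrite scaler_eq0 negb_or => /andP[a0 _]; rewrite memvZ_eq // star_sym.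
    by rewrite rpredDr.
  have a0 : a != 0.
    apply: contraNneq vu' => a0; move: wy; rewrite a0 scale0r add0r memvZ_eq //.
    by rewrite star_sym rpredDl.
  exists (b^-1 * a); first by rewrite mulf_neq0 ?invr_eq0.
  by rewrite -(memvZ_eq _ _ b0) scalerDr scalerA mulVKf // addrC.
have [t et] := sqrt_pchar2 (B u u' / (h * B v v')).
have t0 : t != 0.
  apply: contraNneq buu' => t0; move: et; rewrite t0 expr0n /= => /esym/eqP.
  by rewrite mulf_eq0 invr_eq0 mulf_eq0 (negPf h0) (negPf bvv') !orbF.
pose z := u + t *: v; pose g := u' - (h * t) *: v'.
have z_u : u \in star z by rewrite star_sym rpredD ?star_id // rpredZ.
have z_v : v \in star z.
  by rewrite star_sym rpredD ?rpredZ ?star_id // star_sym.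
(* The star of [z] is the span of [u], [v] and [g], as it does not contain [v']. *)
have zv' : v' \notin star z.
  apply: contra v'u; rewrite star_sym => zv'.
  have : z - t *: v \in star v' by rewrite rpredB ?rpredZ.
  by rewrite addrK star_sym.
have gz : g \in star z.
  have dT : \dim (<[u']> + <[v']>) = 2%N.
    apply: dim_span2 => //; apply: contra v'u => /vlineP[k ->].
    by rewrite rpredZ // star_sym.
  have [w [w0 wT wz]] := star_meets z dT.
  move: wT w0 wz => /add2P[a [b ->]] w0 wz.
  have a0 : a != 0.
    apply: contraNneq zv' => a0; move: w0 wz; rewrite a0 scale0r add0r.
    by rewrite scaler_eq0 negb_or => /andP[b0 _]; rewrite memvZ_eq.
  pose s := a^-1 * b; pose g0 := u' + s *: v'; pose r := h *: u + g0.
  have g0z : g0 \in star z by rewrite -(memvZ_eq _ _ a0) scalerDr scalerA mulVKf.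
  (* [r] is perpendicular to [z], [v' + v] and [h u + s v'], so also to a multiple
     of [v'] that would be nonzero if [g0] were not [g]. *)
  have r_c : h *: u + s *: v' \in star r.
    rewrite star_sym /r /g0 addrCA addrC rpredD ?star_id // star_sym.
    by rewrite rpredD ?rpredZ.
  have r_z : z \in star r by rewrite star_sym rpredD ?rpredZ.
  have r_y : v' + v \in star r.
    rewrite star_sym /r /g0 addrA [h *: u + _]addrC rpredD // rpredZ //.
    by rewrite star_sym rpredD ?star_id.
  have : t *: (v' + v) - z + h^-1 *: (h *: u + s *: v') \in star r.
    by rewrite rpredD ?rpredB ?rpredZ.
  have -> : t *: (v' + v) - z + h^-1 *: (h *: u + s *: v') = (t + h^-1 * s) *: v'.
    by apply/rowP => i; rewrite !mxE; field.
  have [c0|c0] := eqVneq (t + h^-1 * s) 0.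
    move=> _; suff -> : g = g0 by [].
    suff es : s = - (h * t) by rewrite /g /g0 es scaleNr.
    by apply/eqP; rewrite -addr_eq0 addrC -[s](mulVKf h0) -mulrDr c0 mulr0.
  rewrite memvZ_eq // star_sym => rv'; case/negP: v'u; rewrite star_sym.
  rewrite -(memvZ_eq _ _ h0) -[h *: u](addrK g0) -/r rpredB // rpredD ?rpredZ ?star_id //.
  by rewrite star_sym.
have Bgz : B g z = 0.
  apply: form_sym0; rewrite /g /z linearBr !linearDl !linearZr !linearZl_LR /=.
  rewrite (Bmn _ _ u'm vn) (form_sym0 (Bmn _ _ um v'n)).
  have -> : B u u' = h * B v v' * t ^+ 2 by rewrite et mulrC divfK ?mulf_neq0.
  by ring.
have z0 : z != 0.
  apply: contraNneq buu' => z0; have un : u \in n.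
    by rewrite -[u](addrK (t *: v)) -/z z0 sub0r rpredN rpredZ.
  by rewrite (Bmn _ _ u'm un).
exists z => //; apply/eqP; rewrite eqEdim dim_orthov_vec // star_dim // andbT.
have zo_u : u \in orthov B <[z]>.
  rewrite mem_orthov1 linearDr linearZr /= form_alt.
  by rewrite (form_sym0 (Bmn _ _ um vn)) mulr0 addr0.
have zo_v : v \in orthov B <[z]>.
  by rewrite mem_orthov1 linearDr linearZr /= form_alt (Bmn _ _ um vn) mulr0 addr0.
have zo_g : g \in orthov B <[z]> by rewrite mem_orthov1 Bgz.
apply/subvP => w wz.
have : w \in (m + n)%VS by rewrite sum_mn memvf.
move=> /memv_addP[x xm [y yn ew]]; move: wz; rewrite ew {w ew}.
move: xm; rewrite em => /add2P[a [b ->]]; move: yn; rewrite en => /add2P[c [d ->]].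
set w := _ + _ => wz.
have ew : w - (a *: u + c *: v + b *: g) = (d + b * (h * t)) *: v'.
  by apply/rowP => i; rewrite !mxE; ring.
clearbody w g.
have : (d + b * (h * t)) *: v' \in star z by rewrite -ew rpredB ?rpredD ?rpredZ.
have [d0 _|d0] := eqVneq (d + b * (h * t)) 0; last by rewrite memvZ_eq // (negPf zv').
move: ew; rewrite d0 scale0r => /eqP; rewrite subr_eq0 => /eqP->.
by rewrite !rpredD ?rpredZ.
Qed.

End LinearAlgebra.

(** * Ovoidal fibrations *)

Lemma uniq3 (T : eqType) (x y z : T) :
  x <> y -> y <> z -> z <> x -> uniq [:: x; y; z].
Proof.
move=> /eqP xy /eqP yz /eqP zx.
by rewrite /= !inE negb_or xy yz eq_sym zx.
Qed.

Lemma ovoid_cap (F : finFieldType) (O : {set point F}) : ovoid O -> cap O.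
Proof.
move=> [_ nocol] l ll; rewrite leqNgt; apply/negP => /card_gt2P[x [y [z]]].
case=> [[]]; rewrite !inE => /andP[xO xl] /andP[yO yl] /andP[zO zl].
case=> /eqP xy /eqP yz /eqP zx.
apply: (nocol x y z xO yO zO (uniq3 xy yz zx)).
by exists l; rewrite // !in_points.
Qed.

Section Fibration.
Variable F : finFieldType.
Local Notation V := 'rV[F]_4.
Local Notation q := #|F|.
Hypothesis q_even : ~~ odd q.
Hypothesis q_gt2 : 2 < q.
Variable theta : 'I_q.+1 -> {set point F}.
Hypothesis fib : ovoidal_fibration theta.

Lemma sum_sections l : is_line l -> \sum_i sect (theta i) l = q + 1.
Proof.
move=> /eqP dl; have [_ dis cov] := fib.
rewrite addn1; apply: etrans (card_points_line dl); rewrite -[RHS]sum1_card.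
transitivity (\sum_i \sum_(x in points_on l | x \in theta i) 1).
  apply: eq_bigr => i _; rewrite sum1dep_card; apply: eq_card => x.
  by rewrite !inE andbC.
rewrite (exchange_big_dep (fun x => x \in points_on l)) /=; last first.
  by move=> i x _ /andP[].
apply: eq_bigr => x xl; have [i xi] := cov x.
rewrite (bigD1 i) /= ?xl ?xi // big1 // => j /andP[/andP[_ xj] ji].
by have := disjointFr (dis _ _ ji) xj; rewrite xi.
Qed.

(** The [q + 1] points of a line are shared out among sections of at most two
    points; as [q + 1] is odd, some section has one. *)
Lemma tangent_some l : is_line l -> exists i, tangent (theta i) l.
Proof.
move=> ll; have [ov _ _] := fib.
case: (boolP [exists i, odd (sect (theta i) l)]) => [/existsP[i oi]|/existsPn h].
  exists i; apply: tangentI => //.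
  by have := ovoid_cap (ov i) ll; case: (sect _ _) oi => [|[|[|]]].
have : odd (\sum_i sect (theta i) l) = false.
  elim/big_ind: _ => // [a b|i _]; first by rewrite oddD => -> ->.
  by rewrite (negPf (h i)).
by rewrite sum_sections // oddD addbT q_even.
Qed.

(** If the star of [z] were the same for two ovoids of the fibration, the [q]
    planes left could not cover all the lines through [z]. *)
Lemma stars_distinct i j z R : i != j -> is_star (theta i) z R ->
  is_star (theta j) z R -> False.
Proof.
move=> ij [dR zR Ri] [_ _ Rj]; have [ov _ _] := fib.
have star k : exists S, is_star (theta k) z S.
  by have [e _] := ov k; apply: star_exists => //; exact: ovoid_cap (ov k).
have [S starS] := fin_all_exists star.
(* The star of [z] for [theta j] stands in for the one for [theta i]. *)
have covered x : x != z -> exists2 k, k != i & (x <= S k)%VS.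
  move=> xz; rewrite eq_sym in xz; have ll := is_line_join xz.
  have [k tk] := tangent_some ll.
  have [ki|ki] := eqVneq k i; last first.
    exists k => //; have [_ _ Sk] := starS k.
    by rewrite (subv_trans (addvSr z x)) // -Sk ?addvSl.
  exists j; rewrite 1?eq_sym //; have [_ _ Sj] := starS j.
  rewrite (subv_trans (addvSr z x)) // -Sj ?addvSl // Rj ?addvSl // -Ri ?addvSl //.
  by rewrite -ki.
(* Each of the [q] other stars has [q^2 + q] points besides [z]. *)
have : \sum_(x | x != z) 1 <= \sum_(x | x != z) \sum_(k | k != i) (x <= S k)%VS.
  apply: leq_sum => x xz; have [k ki xk] := covered x xz.
  by rewrite (bigD1 k) //= xk.
rewrite exchange_big /= sum1_card.
have in_star k : \sum_(x : point F | x != z) (x <= S k)%VS = q ^ 2 + q.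
  have [dS zS _] := starS k.
  have := card_points_plane dS; rewrite (cardD1 z) in_points zS add1n addn1 => -[<-].
  rewrite -sum1_card big_mkcond [RHS]big_mkcond /=; apply: eq_bigr => x _.
  by rewrite !inE; case: (x != z); case: (x <= S k)%VS.
rewrite (eq_bigr (fun=> q ^ 2 + q)) => [|k _]; last exact: in_star.
rewrite sum_nat_const.
have -> : #|[pred k : 'I_q.+1 | k != i]| = q.
  by have := cardC1 i; rewrite card_ord.
have e : #|[pred x : point F | x != z]| = q ^ 3 + q ^ 2 + q.
  by have := cardC1 z; rewrite card_point addn1.
move=> le; have := leq_trans (eq_leq (esym e)) le.
by move: q_gt2; narith.
Qed.

End Fibration.

Theorem theorem1p2 (n : nat) (F : finFieldType)
    (hF : #|F| = 2 ^ n) (hq : 2 < 2 ^ n)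
    (theta : 'I_#|F|.+1 -> {set point F}) (htheta : ovoidal_fibration theta)
    (B : {skew_symmetric 'rV[F]_4}%R)
    (hB : tangent_symplectic_form B (theta ord0))
    (m : {vspace 'rV[F]_4}) (hm : is_line m) (hm0 : ~~ tangent (theta ord0) m) :
  exists i j : 'I_#|F|.+1,
    [/\ i != ord0, j != ord0, i != j,
        tangent (theta i) m & tangent (theta j) (orthov B m)].
Proof.
have q_gt2 : 2 < #|F| by rewrite hF.
have q_even : ~~ odd #|F| by rewrite hF; case: n hq {hF} => // n _; rewrite oddX.
have pchar2 : 2 \in [pchar F]%R by apply: card_finPcharP hF _.
have [sB iso] := hB.
have miso : ~~ (m <= orthov B m)%VS by apply: contra hm0 => /(iso m hm).
have dn := dim_orthov_line pchar2 sB (eqP hm) miso.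
have ln : is_line (orthov B m) by rewrite /is_line dn.
have [i ti] := tangent_some q_even htheta hm.
have [j tj] := tangent_some q_even htheta ln.
have i0 : i != ord0 by apply: contraNneq hm0 => <-.
have j0 : j != ord0.
  apply: contraNneq (miso) => j0; move: tj; rewrite j0 => /(iso _ ln) nn.
  have : (fullv <= orthov B (orthov B m))%VS.
    by rewrite -(orthov_complement pchar2 sB (eqP hm) miso) subv_add nn orthov_sym subvv.
  have [/eqP rad0 _ _] := sB.
  by rewrite orthov_sym rad0 => /dimvS; rewrite dn dimv0.
exists i, j; split=> //; apply/negP => /eqP eij; rewrite -eij in tj.
have [ov _ _] := htheta; have [cardO _] := ov i; have capO := ovoid_cap (ov i).
(* The stars of points, as a function on vectors; the zero vector is perpendicular
   to everything. *)
have [star starP] : exists star : 'rV[F]_4 -> {vspace 'rV[F]_4}, forall v,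
    (v = 0%R -> star v = fullv) /\
    (forall p : point F, p = <[v]>%VS :> {vspace _} -> is_star (theta i) p (star v)).
  apply: (@fin_all_exists 'rV[F]_4 (fun=> {vspace 'rV[F]_4}) (fun v S =>
    (v = 0%R -> S = fullv) /\
    (forall p : point F, p = <[v]>%VS :> {vspace _} -> is_star (theta i) p S))) => v.
  have [v0|v0] := eqVneq v 0%R.
    exists fullv; split=> // p ep; have := dim_point p.
    by rewrite ep v0 dim_vline eqxx.
  have [S sS] := star_exists q_even q_gt2 capO cardO (vec_point v0).
  exists S; split=> [v0'|p ep]; first by have := v0; rewrite v0' eqxx.
  by have -> : p = vec_point v0 by exact: val_inj.
have star0 : star 0%R = fullv by have [-> //] := starP 0%R.
have star_vec v (v0 : v != 0%R) : is_star (theta i) (vec_point v0) (star v).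
  by have [_ sv] := starP v; exact: sv.
have star_id v : v \in star v.
  have [->|v0] := eqVneq v 0%R; first by rewrite mem0v.
  by have [_ + _] := star_vec v v0; rewrite -memvE.
have star_tan u v l (u0 : u != 0%R) : is_line l -> u \in l -> v \in l ->
    v \notin <[u]>%VS -> (v \in star u) = tangent (theta i) l.
  move=> ll ul vl vu; have [_ us tl] := star_vec u u0.
  rewrite tl // -?memvE // (span2 (eqP ll) ul vl u0 vu) subv_add us.
  by rewrite memvE.
have star_sym v w : (w \in star v) = (v \in star w).
  have [->|v0] := eqVneq v 0%R; first by rewrite mem0v star0 memvf.
  have [->|w0] := eqVneq w 0%R; first by rewrite mem0v star0 memvf.
  have [/vlineP[k e]|wv] := boolP (w \in <[v]>%VS).
    have k0 : k != 0%R by apply: contraNneq w0 => k0; rewrite e k0 scale0r.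
    have -> : v \in star w by rewrite -(memvZ_eq _ _ k0) -e.
    by rewrite e rpredZ.
  have vw : v \notin <[w]>%VS.
    apply: contra wv => /vlineP[k e]; have k0 : k != 0%R.
      by apply: contraNneq v0 => k0; rewrite e k0 scale0r.
    by rewrite -(memvZ_eq _ _ k0) -e memv_line.
  have ll : is_line (<[v]> + <[w]>)%VS by rewrite /is_line dim_span2.
  have vl : v \in (<[v]> + <[w]>)%VS by rewrite memvE addvSl.
  have wl : w \in (<[v]> + <[w]>)%VS by rewrite memvE addvSr.
  by rewrite (star_tan v w _ v0 ll vl wl wv) (star_tan w v _ w0 ll wl vl vw).
have star_dim v : v != 0%R -> \dim (star v) = 3.
  by move=> v0; have [] := star_vec v v0.
have star_iso l : tangent (theta i) l -> forall u, u \in l -> (l <= star u)%VS.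
  move=> tl u ul; have [->|u0] := eqVneq u 0%R; first by rewrite star0 subvf.
  have [_ _ tan] := star_vec u u0.
  by rewrite -tan ?(tangent_line tl) // -memvE.
have [z z0 ez] := star_meets_orthov pchar2 sB star_sym star_id star_dim (eqP hm) miso
  (star_iso _ ti) (star_iso _ tj).
apply: (stars_distinct q_even q_gt2 htheta i0 (z := vec_point z0) (R := star z)).
  exact: star_vec.
split=> [||l ll zl]; rewrite ?star_dim //= -?memvE //.
rewrite /= -memvE in zl; rewrite ez; apply/idP/idP => [/(iso l ll) lo|lz].
  by rewrite orthov_sym (subv_trans _ lo) // -memvE.
apply/(iso l ll); have dz : \dim <[z]> < \dim l by rewrite (eqP ll) dim_vline z0.
have /subvPn[w wl wz] : ~~ (l <= <[z]>)%VS.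
  by apply: contraL dz => /dimvS; rewrite -leqNgt.
have el := span2 (eqP ll) zl wl z0 wz.
have wo : w \in orthov B <[z]> by rewrite (subvP lz).
have alt := form_alt pchar2 sB.
by rewrite el orthovD !subv_add -!memvE !mem_orthov1 !alt !eqxx -!mem_orthov1 wo
   mem_orthov1_sym wo.
Qed.
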